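(* Let $S\subseteq\mathbb{N}^2$ be an Arf good semigroup with multiplicity vector $\boldsymbol{e}=(e_1,e_2)$. Then $\operatorname{edim}(S)=e_1+e_2$.
   Context: $\mathbb{N}=\{0,1,2,\dots\}$. A submonoid $S$ of $(\mathbb{N}^2,+)$ is a good semigroup if: (G1) $\boldsymbol{\alpha},\boldsymbol{\beta}\in S$ implies $\min(\boldsymbol{\alpha},\boldsymbol{\beta})=(\min\{\alpha_1,\beta_1\},\min\{\alpha_2,\beta_2\})\in S$; (G2) there is $\boldsymbol{\delta}\in\mathbb{N}^2$ with $\boldsymbol{\delta}+\mathbb{N}^2\subseteq S$; (G3) if $\boldsymbol{\alpha},\boldsymbol{\beta}\in S$, $\boldsymbol{\alpha}\ne\boldsymbol{\beta}$ and $\alpha_i=\beta_i$ for some $i$, then there is $\boldsymbol{\epsilon}\in S$ with $\epsilon_i>\alpha_i=\beta_i$ and $\epsilon_j\ge\min\{\alpha_j,\beta_j\}$ for $j\neq i$, with equality if $\alpha_j\ne\beta_j$. Good semigroups are always assumed local: if $\boldsymbol{\alpha}\in S$ has a zero coordinate, then $\boldsymbol{\alpha}=\boldsymbol{0}$. The multiplicity vector of $S$ is $\boldsymbol{e}=(e_1,e_2)=\min(S\setminus\{\boldsymbol{0}\})$ (minimum for the componentwise order). A good semigroup $S$ is Arf if for every $\boldsymbol{\alpha}\in S$, with $S(\boldsymbol{\alpha})=\{\boldsymbol{\beta}\in S:\boldsymbol{\beta}\ge\boldsymbol{\alpha}\}$ (componentwise order), the set $S(\boldsymbol{\alpha})-\boldsymbol{\alpha}$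 is a semigroup. Let $\overline{\mathbb{N}}=\mathbb{N}\cup\{\infty\}$ with $a<\infty$ for $a\in\mathbb{N}$ and $x+\infty=\infty$ for all $x$. Put $S_1^\infty=\{(a,\infty): a\in\mathbb{N},\ \exists\,\tilde y\ \forall y\ge\tilde y,\ (a,y)\in S\}$, $S_2^\infty=\{(\infty,b): b\in\mathbb{N},\ \exists\,\tilde x\ \forall x\ge\tilde x,\ (x,b)\in S\}$, $S^\infty=S_1^\infty\cup S_2^\infty\cup\{(\infty,\infty)\}$, $\Gamma_S=S\cup S^\infty$. A good semigroup is identified with $\Gamma_S$, so ''$S$ contains $\eta$'' means $\eta\subseteq\Gamma_S$. $\boldsymbol{\alpha}\in\Gamma_S\setminus\{\boldsymbol{0}\}$ is irreducible if $\boldsymbol{\alpha}=\boldsymbol{\beta}+\boldsymbol{\gamma}$ with $\boldsymbol{\beta},\boldsymbol{\gamma}\in\Gamma_S$ implies $\boldsymbol{\alpha}=\boldsymbol{\beta}$ or $\boldsymbol{\alpha}=\boldsymbol{\gamma}$. $\boldsymbol{\alpha}\in\Gamma_S$ is absolute if $\boldsymbol{\alpha}\in S^\infty$, or $\boldsymbol{\alpha}\in S\cap\mathbb{N}^2$ and no $\boldsymbol{\beta}\in S\cap\mathbb{N}^2$ satisfies ($\beta_1=\alpha_1,\beta_2>\alpha_2$) or ($\beta_2=\alpha_2,\beta_1>\alpha_1$). $I_A(S)$ is the set of irreducible absolute elements of $\Gamma_S$. For $\eta\subseteq\overline{\mathbb{N}}^2$, $S_\eta$ is the family of good semigroups containing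 $\eta$ that are minimal for inclusion among good semigroups containing $\eta$. The embedding dimension of $S$ is $\operatorname{edim}(S)=\min\{|\eta|: \eta\subseteq I_A(S),\ S\in S_\eta\}$. *)

(* Defs.v *)
From mathcomp Require Import all_boot all_order all_algebra.
From mathcomp Require Import boolp classical_sets functions cardinality.

Set Implicit Arguments.
Unset Strict Implicit.
Unset Printing Implicit Defensive.

Local Open Scope classical_set_scope.
Local Open Scope card_scope.

(* On nat * nat, the ring-scope 0 and + are the componentwise ones. *)

Definition le2 (a b : nat * nat) : Prop := (a.1 <= b.1)%N /\ (a.2 <= b.2)%N.

Definition min2 (a b : nat * nat) : nat * nat := (minn a.1 b.1, minn a.2 b.2).

Definition submonoid (S : set (nat * nat)) : Prop :=
  S 0%R /\ forall a b, S a -> S b -> S (a + b)%R.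

Definition axiomG1 (S : set (nat * nat)) : Prop :=
  forall a b, S a -> S b -> S (min2 a b).

Definition axiomG2 (S : set (nat * nat)) : Prop :=
  exists d : nat * nat, forall b, S (d + b)%R.

Definition axiomG3 (S : set (nat * nat)) : Prop :=
  forall a b, S a -> S b -> a <> b ->
    (a.1 = b.1 -> exists eps, [/\ S eps, (a.1 < eps.1)%N,
       (minn a.2 b.2 <= eps.2)%N & a.2 <> b.2 -> eps.2 = minn a.2 b.2]) /\
    (a.2 = b.2 -> exists eps, [/\ S eps, (a.2 < eps.2)%N,
       (minn a.1 b.1 <= eps.1)%N & a.1 <> b.1 -> eps.1 = minn a.1 b.1]).

Definition local (S : set (nat * nat)) : Prop :=
  forall a, S a -> a.1 = 0%N \/ a.2 = 0%N -> a = 0%R.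

(* Good semigroups are local by convention, so the minimality in
   [minimal_good] below also ranges over local ones only. *)
Definition good_semigroup (S : set (nat * nat)) : Prop :=
  [/\ submonoid S, axiomG1 S, axiomG2 S, axiomG3 S & local S].

Definition multiplicity_vector (S : set (nat * nat)) (e : nat * nat) : Prop :=
  [/\ S e, e <> 0%R & forall a, S a -> a <> 0%R -> le2 e a].

Definition above (S : set (nat * nat)) (a : nat * nat) : set (nat * nat) :=
  [set b | S b /\ le2 a b].

(* The subtractions are exact on [above S a]. *)
Definition arf (S : set (nat * nat)) : Prop :=
  forall a, S a ->
    submonoid [set ((b.1 - a.1)%N, (b.2 - a.2)%N) | b in above S a].

(* N together with infinity, the latter being None. *)
Definition natbar : Type := option nat.

Definition addb (x y : natbar) : natbar :=
  if x is Some m then if y is Some n then Some (m + n)%N else None else None.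

Definition add2b (a b : natbar * natbar) : natbar * natbar :=
  (addb a.1 b.1, addb a.2 b.2).

Definition fin2 (a : nat * nat) : natbar * natbar := (Some a.1, Some a.2).

Definition S1inf (S : set (nat * nat)) : set (natbar * natbar) :=
  [set (Some a, None) | a in
    [set a : nat | exists y0, forall y, (y0 <= y)%N -> S (a, y)]].

Definition S2inf (S : set (nat * nat)) : set (natbar * natbar) :=
  [set (None, Some b) | b in
    [set b : nat | exists x0, forall x, (x0 <= x)%N -> S (x, b)]].

Definition Sinf (S : set (nat * nat)) : set (natbar * natbar) :=
  S1inf S `|` S2inf S `|` [set (None, None)].

Definition Gamma (S : set (nat * nat)) : set (natbar * natbar) :=
  fin2 @` S `|` Sinf S.

Definition irreducible (S : set (nat * nat)) (a : natbar * natbar) : Prop :=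
  [/\ Gamma S a, a <> fin2 0%R &
    forall b c, Gamma S b -> Gamma S c -> a = add2b b c -> a = b \/ a = c].

Definition absolute (S : set (nat * nat)) (a : natbar * natbar) : Prop :=
  Sinf S a \/
  exists a', [/\ S a', a = fin2 a' &
    ~ exists b, S b /\ ((b.1 = a'.1 /\ (a'.2 < b.2)%N) \/
                        (b.2 = a'.2 /\ (a'.1 < b.1)%N))].

Definition IA (S : set (nat * nat)) : set (natbar * natbar) :=
  [set a | irreducible S a /\ absolute S a].

Definition minimal_good (eta : set (natbar * natbar)) (S : set (nat * nat)) :
    Prop :=
  [/\ good_semigroup S, eta `<=` Gamma S &
    forall T, good_semigroup T -> eta `<=` Gamma T -> T `<=` S -> T = S].

Definition generating (S : set (nat * nat)) (eta : set (natbar * natbar)) :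
    Prop :=
  eta `<=` IA S /\ minimal_good eta S.

(* edim S = n: the least cardinality of a set eta with [generating S eta] is
   attained and equal to n.  Sets eta are not assumed finite. *)
Definition edim_eq (S : set (nat * nat)) (n : nat) : Prop :=
  (exists eta, generating S eta /\ eta #= `I_n) /\
  (forall eta, generating S eta -> `I_n #<= eta).

(* Main.v *)
Require Import Defs.
From mathcomp Require Import all_boot all_order all_algebra.
From mathcomp Require Import boolp classical_sets functions cardinality.
From mathcomp Require Import zify.

Set Implicit Arguments.
Unset Strict Implicit.
Unset Printing Implicit Defensive.

Local Open Scope nat_scope.
Local Open Scope classical_set_scope.

(* Write A for the set of a with (a, oo) in Gamma S, and B for that of b with
   (oo, b) in Gamma S. For Arf S, a point (a, b) of S has a in A iff b in B, all
   of A x B is in S, and the coordinates of any other point of S determine it: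
   S is a finite chain followed by a product. A sum of two nonzero elements is e
   plus a nonzero element, so (x, oo) is irreducible iff x is least in A within
   its residue class modulo e1; this gives e1 + e2 infinite irreducibles. Each
   finite irreducible absolute c lies in the chain, and c, c + e, c + 2e, ...
   leaves the chain at some (x, y) with (x, oo) and (oo, y) irreducible;
   different c give different x and different y.
     A generating set contains every c, at least one of (x, oo) and (oo, y) for
   each such exit (x, y), and every other infinite irreducible: otherwise
   removing from S the points above or to the right of a suitable (x, y) leaves
   a good semigroup. Conversely, dropping all the (x, oo) coming from exits still
   generates S, since (G3) recovers (x, oo) from (x, y) and the (oo, b). *)

(** * The exchange of coordinates, and good semigroups coordinatewise *)

(** Serves to deduce statements about rows from those about columns. *)
Definition swap_set (S : set (nat * nat)) : set (nat * nat) :=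
  [set p | S (p.2, p.1)].

(* The [a] with [(a, oo)] in [Gamma S]; the [b] with [(oo, b)] in [Gamma S] are
   then the elements of [ray (swap_set S)]. *)
Definition ray (S : set (nat * nat)) : set nat :=
  [set a | exists y0, forall y, y0 <= y -> S (a, y)].

Section GoodSemigroup.
Variable S : set (nat * nat).
Hypothesis gS : good_semigroup S.

Lemma good_zero : S (0, 0).
Proof. by case: gS => -[]. Qed.

Lemma good_add a b c d : S (a, b) -> S (c, d) -> S (a + c, b + d).
Proof. by case: gS => -[_ h] _ _ _ _; apply: h. Qed.

Lemma good_min a b c d : S (a, b) -> S (c, d) -> S (minn a c, minn b d).
Proof. by case: gS => _ h _ _ _; apply: h. Qed.

Lemma good_conductor : exists n, forall a b, n <= a -> n <= b -> S (a, b).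
Proof.
case: gS => _ _ [[d1 d2] hd] _ _; exists (maxn d1 d2) => a b ha hb.
have : S (d1 + (a - d1), d2 + (b - d2)) := hd (a - d1, b - d2).
by rewrite !subnKC //; lia.
Qed.

Lemma good_local a b : S (a, b) -> a = 0 \/ b = 0 -> a = 0 /\ b = 0.
Proof. by case: gS => _ _ _ _ h hS h0; case: (h _ hS h0) => -> ->. Qed.

(** As [b] and [b'] differ, the equality clause of (G3) puts the new point exactly in the lower
    row. *)
Lemma good_right a b b' :
  S (a, b) -> S (a, b') -> b < b' -> exists2 a', a < a' & S (a', b).
Proof.
case: gS => _ _ _ h _ h1 h2 lt.
have ne : (a, b) <> (a, b') by case=> E; rewrite E ltnn in lt.
have [/(_ erefl) [[u v] [hS /= lu _ E]] _] := h _ _ h1 h2 ne.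
have hv : v = b by rewrite E; lia.
by exists u => //; rewrite -hv.
Qed.

Lemma good_up a a' b :
  S (a, b) -> S (a', b) -> a < a' -> exists2 b', b < b' & S (a, b').
Proof.
case: gS => _ _ _ h _ h1 h2 lt.
have ne : (a, b) <> (a', b) by case=> E; rewrite E ltnn in lt.
have [_ /(_ erefl) [[u v] [hS /= lu _ E]]] := h _ _ h1 h2 ne.
have hu : u = a by rewrite E; lia.
by exists v => //; rewrite -hu.
Qed.

End GoodSemigroup.

(** Distinct points that agree in one coordinate differ in the other, so (G3) always comes with its
    equality clause. *)
Lemma good_intro (S : set (nat * nat)) :
  S (0, 0) ->
  (forall a b c d, S (a, b) -> S (c, d) -> S (a + c, b + d)) ->
  (forall a b c d, S (a, b) -> S (c, d) -> S (minn a c, minn b d)) ->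
  (exists n, forall a b, n <= a -> n <= b -> S (a, b)) ->
  (forall a b b', S (a, b) -> S (a, b') -> b < b' ->
     exists2 a', a < a' & S (a', b)) ->
  (forall a a' b, S (a, b) -> S (a', b) -> a < a' ->
     exists2 b', b < b' & S (a, b')) ->
  (forall a b, S (a, b) -> a = 0 \/ b = 0 -> a = 0 /\ b = 0) ->
  good_semigroup S.
Proof.
move=> S0 SD Smin [n Sn] Sr Su Sl; split.
- by split=> // -[a b] [c d]; apply: SD.
- by move=> [a b] [c d]; apply: Smin.
- by exists (n, n) => -[a b]; apply: Sn; rewrite leq_addr.
- move=> [a b] [c d] /= h1 h2 ne; split=> E; subst.
  + have [lt|lt|E] := ltngtP b d; last by rewrite E in ne.
    * have [u lu hS] := Sr _ _ _ h1 h2 lt; exists (u, b); split=> //=; lia.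
    * have [u lu hS] := Sr _ _ _ h2 h1 lt; exists (u, d); split=> //=; lia.
  + have [lt|lt|E] := ltngtP a c; last by rewrite E in ne.
    * have [u lu hS] := Su _ _ _ h1 h2 lt; exists (a, u); split=> //=; lia.
    * have [u lu hS] := Su _ _ _ h2 h1 lt; exists (c, u); split=> //=; lia.
- by move=> [a b] h /(Sl _ _ h) [-> ->].
Qed.

Lemma good_swap S : good_semigroup S -> good_semigroup (swap_set S).
Proof.
move=> gS; apply: good_intro; rewrite /swap_set /=.
- exact: good_zero.
- by move=> *; apply: good_add.
- by move=> *; apply: good_min.
- by have [n hn] := good_conductor gS; exists n => a b ha hb; apply: hn.
- by move=> a b b'; apply: good_up.
- by move=> a b b'; apply: good_right.
- by move=> a b h /or_comm h0; have [-> ->] := good_local gS h h0.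
Qed.

(** The Arf condition at [(a, b)], freed of truncated subtraction. *)
Lemma arfD S a b u v u' v' : arf S -> S (a, b) -> S (a + u, b + v) ->
  S (a + u', b + v') -> S (a + (u + u'), b + (v + v')).
Proof.
move=> aS h h1 h2; have [_ hD] := aS _ h.
have im x y : S (a + x, b + y) ->
    [set (p.1 - a, p.2 - b) | p in above S (a, b)] (x, y).
  move=> hx; exists (a + x, b + y); last by rewrite /= !addKn.
  by split=> //; split; rewrite /= leq_addr.
have [[p q] [hS [/= l1 l2]] [E1 E2]] := hD _ _ (im _ _ h1) (im _ _ h2).
have -> : a + (u + u') = p by rewrite -[u + u']E1 subnKC.
by have -> : b + (v + v') = q by rewrite -[v + v']E2 subnKC.
Qed.

Lemma arf_swap S : arf S -> arf (swap_set S).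
Proof.
move=> aS [a b] h; split.
  by exists (a, b); [split=> //; split | rewrite /= !subnn].
move=> x y [[p q] [hp [/= l1 l2]] <-] [[p' q'] [hp' [/= l1' l2']] <-].
exists (a + (p - a + (p' - a)), b + (q - b + (q' - b))); last by rewrite /= !addKn.
split; last by split; rewrite /= leq_addr.
by apply: (@arfD S b a) => //; rewrite !subnKC.
Qed.

(** * Columns and rows of an Arf good semigroup *)

Section Columns.
Variable S : set (nat * nat).
Hypotheses (gS : good_semigroup S) (aS : arf S).

(* Arfness at [(a, b)] gives [(a, b + k(b' - b))] in [S] for all [k]; a minimum
   with an element beyond the conductor then gives [(a, y)] for all large [y]. *)
Lemma ray_of_column a b b' : S (a, b) -> S (a, b') -> b < b' -> ray S a.
Proof.
move=> h h' lt; have [n hn] := good_conductor gS.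
have hk k : S (a, b + k * (b' - b)).
  elim: k => [|k IH]; first by rewrite addn0.
  rewrite mulSn -[a]addn0 -[0]/(0 + 0); apply: arfD => //; rewrite addn0 //.
  by rewrite subnKC // ltnW.
exists n => y hy; have := good_min gS (hk y) (hn (maxn a n) y _ hy).
rewrite (minn_idPl (leq_maxl _ _)) (minn_idPr _); first by apply; lia.
by nia.
Qed.

End Columns.

Section Rows.
Variable S : set (nat * nat).
Hypotheses (gS : good_semigroup S) (aS : arf S).

Lemma ray_swap_of_row a a' b :
  S (a, b) -> S (a', b) -> a < a' -> ray (swap_set S) b.
Proof. exact: (@ray_of_column _ (good_swap gS) (arf_swap aS) b a a'). Qed.

(** (G3) turns two points of a column into two points of the row of the lower one. *)
Lemma ray_swap_of_column a b b' :
  S (a, b) -> S (a, b') -> b < b' -> ray (swap_set S) b.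
Proof.
move=> h h' lt; have [a' lt' h2] := good_right gS h h' lt.
exact: ray_swap_of_row h h2 lt'.
Qed.

Lemma ray_swapP a b : S (a, b) -> ray S a -> ray (swap_set S) b.
Proof.
move=> h [y0 hy]; apply: (ray_swap_of_column h (hy (maxn y0 b.+1) _)); lia.
Qed.

(** The point is the minimum of a high point of column [a] and a far point of row [b]. *)
Lemma ray_box a b : ray S a -> ray (swap_set S) b -> S (a, b).
Proof.
move=> [y0 ha] [x0 hb].
have := good_min gS (ha (maxn y0 b) (leq_maxl _ _)) (hb (maxn x0 a) (leq_maxl _ _)).
by rewrite (minn_idPl (leq_maxr _ _)) (minn_idPr (leq_maxr _ _)).
Qed.

Lemma ray0 : ~ ray S 0.
Proof.
move=> [y0 h]; by have [|_] := good_local gS (h y0.+1 (leqnSn _)); first left.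
Qed.

Lemma rayD a c d : ray S a -> S (c, d) -> ray S (a + c).
Proof.
move=> [y0 ha] hc; exists (y0 + d) => y hy.
have -> : y = y - d + d by lia.
by apply: good_add => //; apply: ha; lia.
Qed.

Lemma column_unique a b b' : S (a, b) -> S (a, b') -> ~ ray S a -> b = b'.
Proof.
move=> h h' nA; have [lt|lt|//] := ltngtP b b'; case: nA.
  exact: ray_of_column h h' lt.
exact: ray_of_column h' h lt.
Qed.

End Rows.

Section BothCoordinates.
Variable S : set (nat * nat).
Hypotheses (gS : good_semigroup S) (aS : arf S).

Lemma rayP a b : S (a, b) -> ray (swap_set S) b -> ray S a.
Proof. by move=> h hb; apply: (ray_swapP (good_swap gS) (arf_swap aS) h). Qed.

Lemma row_unique a a' b : S (a, b) -> S (a', b) -> ~ ray S a -> a = a'.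
Proof.
move=> h h' nA; apply: (column_unique (good_swap gS) (arf_swap aS) h h').
by move=> hb; apply: nA; apply: rayP hb.
Qed.

Lemma ray_cofinite : exists n, forall a, n <= a -> ray S a.
Proof.
have [n hn] := good_conductor gS; exists n => a ha; exists n => y hy; exact: hn.
Qed.

End BothCoordinates.

(** * Trimming a column and a row *)

(* [x = 0] or [y = 0] is allowed, and then only part of one column or one row
   is removed. *)
Definition trim (S : set (nat * nat)) (x y : nat) : set (nat * nat) :=
  [set p | S p /\ ~ ((p.1 = x /\ y < p.2) \/ (p.2 = y /\ x < p.1))].

(** A column other than [x] loses at most its point in row [y], so it remains infinite; likewise for
    rows. *)
Lemma Gamma_trim S x y p : Gamma S p -> ~ Gamma (trim S x y) p ->
  [\/ p = (Some x, None) /\ ray S x,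
      p = (None, Some y) /\ ray (swap_set S) y |
      exists2 q, p = fin2 q & S q /\ ~ trim S x y q].
Proof.
move=> [[q hq <-] nh|].
  by apply: Or33; exists q => //; split=> // hT; apply: nh; left; exists q.
move=> [[[a [y0 ha] <-]|[b [x0 hb] <-]]|->] nh; last by case: nh; right; right.
- have [E|ne] := eqVneq a x.
    by apply: Or31; rewrite -E; split=> //; exists y0.
  case: nh; right; left; left; exists a => //; exists (maxn y0 y.+1) => v hv.
  by split=> /=; [apply: ha; lia | lia].
- have [E|ne] := eqVneq b y.
    by apply: Or32; rewrite -E; split=> //; exists x0.
  case: nh; right; left; right; exists b => //; exists (maxn x0 x.+1) => u hu.
  by split=> /=; [apply: hb; lia | lia].
Qed.

Section Trim.
Variable S : set (nat * nat).
Hypotheses (gS : good_semigroup S) (aS : arf S).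
Variables x y : nat.
Hypothesis sum_x : forall a b c d, S (a, b) -> S (c, d) -> 0 < a -> 0 < c ->
  a + c = x -> b + d <= y.
Hypothesis sum_y : forall a b c d, S (a, b) -> S (c, d) -> 0 < a -> 0 < c ->
  b + d = y -> a + c <= x.
Hypothesis ray_x : ray S x -> y = 0 \/ ray (swap_set S) y.
Hypothesis ray_y : ray (swap_set S) y -> x = 0 \/ ray S x.

(** [sum_x] and [sum_y] keep sums of nonzero elements out of the removed part; [ray_x] and [ray_y]
    put the corner [(x, y)] in [S] where (G3) needs it. *)
Lemma good_trim : good_semigroup (trim S x y).
Proof.
apply: good_intro.
- by split; [exact: good_zero | move=> /= [|] [_]].
- move=> a b c d [h h'] [k k']; split; first exact: good_add.
  case: (posnP a) => [a0|ap].
    have [_ b0] := good_local gS h (or_introl a0).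
    by move: a0 b0 => -> ->.
  case: (posnP c) => [c0|cp].
    have [_ d0] := good_local gS k (or_introl c0).
    by move: c0 d0 => -> ->; rewrite !addn0.
  move: (sum_x h k ap cp) (sum_y h k ap cp) => /= hx hy; lia.
- move=> a b c d [h h'] [k k']; split; first exact: good_min.
  move: h' k' => /= h' k'; lia.
- have [n hn] := good_conductor gS; exists (maxn n (maxn x y).+1) => a b ha hb.
  split; first by apply: hn; lia.
  by move=> /=; lia.
- move=> a b b' [h nh] [h' nh'] lt; move: nh nh' => /= nh nh'.
  have hb := ray_swap_of_column gS aS h h' lt.
  have [Eb|Nb] := eqVneq b y.
    have lx : a < x by lia.
    (* Row [y] is cut beyond [x], so the corner serves as the point to the right of [(a, y)]. *)
    exists x => //; split=> /=; last by lia.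
    rewrite Eb in hb *; apply: (ray_box gS _ hb).
    by case: (ray_y hb) => // x0; rewrite x0 in lx.
  case: (hb) => x0 hx0; exists (maxn x0 (a + x).+1); first by lia.
  by split=> /=; [apply: hx0; lia | lia].
- move=> a a' b [h nh] [h' nh'] lt; move: nh nh' => /= nh nh'.
  have ha := rayP gS aS h (ray_swap_of_row gS aS h h' lt).
  have [Ea|Na] := eqVneq a x.
    have ly : b < y by lia.
    exists y => //; split=> /=; last by lia.
    rewrite Ea in ha *; apply: (ray_box gS ha).
    by case: (ray_x ha) => // y0; rewrite y0 in ly.
  case: (ha) => y0 hy0; exists (maxn y0 (b + y).+1); first by lia.
  by split=> /=; [apply: hy0; lia | lia].
- by move=> a b [h _]; apply: (good_local gS h).
Qed.

(** The trimmed set is a good semigroup strictly inside [S], so by minimality it does not contain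
    [eta]. *)
Lemma generating_meets_trim eta u v :
  generating S eta -> S (u, v) -> ~ trim S x y (u, v) ->
  exists2 p, eta p & Gamma S p /\ ~ Gamma (trim S x y) p.
Proof.
move=> [_ [_ sub min]] h nh; apply: contrapT => no; case: nh.
have -> // : trim S x y = S; apply: min => //; first exact: good_trim.
- by move=> p hp; apply: contrapT => np; apply: no; exists p => //; split=> //; apply: sub.
- by move=> p [].
Qed.

End Trim.

(** * Elements of [Gamma] according to their infinite coordinates *)

Section GammaElements.
Variable S : set (nat * nat).

Lemma Gamma_fin a b : Gamma S (Some a, Some b) <-> S (a, b).
Proof.
split=> [[[[u v] hS [<- <-]] //|[[[]|[]]|]]|h]; try by move=> ? ? [].
  by [].
by left; exists (a, b).
Qed.

Lemma Gamma_col a : Gamma S (Some a, None) <-> ray S a.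
Proof.
split=> [[[? _ [//]]|[[[u hu [<-]] //|[? _ [//]]]|//]]|h].
by right; left; left; exists a.
Qed.

Lemma Gamma_row b : Gamma S (None, Some b) <-> ray (swap_set S) b.
Proof.
split=> [[[? _ [//]]|[[[? _ [//]]|[u hu [<-]] //]|//]]|h].
by right; left; right; exists b.
Qed.

End GammaElements.

Lemma Gamma_swap S u v : Gamma (swap_set S) (v, u) <-> Gamma S (u, v).
Proof.
case: u v => [u|] [v|].
- by rewrite !Gamma_fin.
- by rewrite Gamma_col Gamma_row.
- by rewrite Gamma_col Gamma_row.
- by split=> _; right; right.
Qed.

(** * Least elements of residue classes *)

Lemma ray_mulD T x e y k :
  good_semigroup T -> ray T x -> T (e, y) -> ray T (x + k * e).
Proof.
move=> gT ax hT; elim: k => [|k IH]; first by rewrite addn0.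
by rewrite mulSn addnCA addnC; apply: rayD hT.
Qed.

(** Applied to rays, with [e] a coordinate of the multiplicity vector: such [x] index the
    irreducible infinite elements. The lower bound on [A] makes [x - e] exact. *)
Lemma least_residue (A : set nat) e r : 0 < e ->
  (exists n, forall a, n <= a -> A a) -> (forall a, A a -> e <= a) -> r < e ->
  exists x, [/\ A x, ~ A (x - e), x %% e = r &
    forall a, A a -> a %% e = r -> exists k, a = x + k * e].
Proof.
move=> e0 [n hn] Age re.
have ex : exists a, `[< A a >] && (a %% e == r).
  exists (n * e + r); rewrite modnMDl modn_small // eqxx andbT.
  by apply/asboolP/hn; nia.
case: (ex_minnP ex) => x /andP [/asboolP Ax /eqP xr] min; exists x; split=> //.
  move=> Axe; have le := Age _ Ax.
  have /min : `[< A (x - e) >] && ((x - e) %% e == r).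
    apply/andP; split; first exact/asboolP.
    by rewrite -xr -[in X in _ == X](subnK le) modnDr.
  by move=> ?; lia.
move=> a Aa ar; exists ((a - x) %/ e).
have le : x <= a by apply: min; rewrite ar eqxx andbT; apply/asboolP.
rewrite divnK ?subnKC // -eqn_mod_dvd //; by rewrite ar xr.
Qed.

(** If [x' = x + k * e] with [k > 0], then [x' - e] would still be in [A]. *)
Lemma least_inj (A : set nat) e x x' : 0 < e ->
  (forall a k, A a -> A (a + k * e)) -> A x -> ~ A (x - e) -> A x' -> ~ A (x' - e) ->
  x = x' %[mod e] -> x = x'.
Proof.
move=> e0 AD; wlog le : x x' / x <= x'.
  move=> wl ax nx ax' nx' E; case: (leqP x x') => le; first exact: wl.
  by apply/esym/wl => //; exact: ltnW.
move=> ax nx ax' nx' E.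
have [k Ek] : exists k, x' = x + k * e.
  exists ((x' - x) %/ e); rewrite divnK ?subnKC // -eqn_mod_dvd //; exact/eqP.
case: k Ek => [|k] Ek; first by rewrite Ek addn0.
by case: nx'; rewrite Ek mulSn (_ : _ - e = x + k * e); [exact: AD | lia].
Qed.

(** * The multiplicity vector and the irreducible absolute elements *)

Section Multiplicity.
Variables (S : set (nat * nat)) (e1 e2 : nat).
Hypotheses (gS : good_semigroup S) (aS : arf S).
Hypothesis mS : multiplicity_vector S (e1, e2).

Lemma good_gt0 a b : S (a, b) -> (0 < a) = (0 < b).
Proof.
move=> h; apply/idP/idP; rewrite !lt0n; apply: contra => /eqP E.
  by have [-> _] := good_local gS h (or_intror E).
by have [_ ->] := good_local gS h (or_introl E).
Qed.

Lemma mult_in : S (e1, e2).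
Proof. by case: mS. Qed.

Lemma mult_gt0 : 0 < e1.
Proof.
case: mS => h ne _; rewrite lt0n; apply/eqP => E; apply: ne.
by have [-> ->] := good_local gS h (or_introl E).
Qed.

Lemma mult_gt0r : 0 < e2.
Proof. by rewrite -(good_gt0 mult_in) mult_gt0. Qed.

Lemma mult_le a b : S (a, b) -> 0 < a -> e1 <= a /\ e2 <= b.
Proof.
case: mS => _ _ h hS a0; apply: (h _ hS) => -[E _].
by rewrite E in a0.
Qed.

Lemma ray_mult_le a : ray S a -> e1 <= a.
Proof.
move=> ha; have [y0 hy] := ha.
case: (posnP a) => [a0|ap]; first by case: (ray0 gS); rewrite -a0.
by case: (mult_le (hy _ (leqnn _)) ap).
Qed.

Lemma add_mul_mult a b k : S (a, b) -> S (a + k * e1, b + k * e2).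
Proof.
move=> h; elim: k => [|k IH]; first by rewrite !addn0.
rewrite !mulSn !(addnCA _ e1) !(addnCA _ e2).
exact: good_add mult_in IH.
Qed.

(** Arfness at the multiplicity vector, which lies below both summands. *)
Lemma arf_sum a b c d : S (a, b) -> S (c, d) -> 0 < a -> 0 < c ->
  S (a + c - e1, b + d - e2).
Proof.
move=> h k ap cp; have [l1 l2] := mult_le h ap; have [l3 l4] := mult_le k cp.
have -> : a + c - e1 = e1 + ((a - e1) + (c - e1)) by lia.
have -> : b + d - e2 = e2 + ((b - e2) + (d - e2)) by lia.
by apply: (arfD aS mult_in); rewrite !subnKC.
Qed.

(** The minimum with a high point of column [e1] is [(e1, b)]; off the rays, a row has only one
    point, so [a = e1]. *)
Lemma ray_le_mult a : ray S e1 -> forall b, S (a, b) -> 0 < a -> ray S a.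
Proof.
move=> [y0 hy] b h ap; apply: contrapT => na.
have [l _] := mult_le h ap.
have := good_min gS h (hy (maxn y0 b) (leq_maxl _ _)).
rewrite (minn_idPr l) (minn_idPl (leq_maxr _ _)) => h'.
by case: (na); rewrite (row_unique gS aS h h' na); exists y0.
Qed.

Lemma multiplicity_swap : multiplicity_vector (swap_set S) (e2, e1).
Proof.
case: mS => h ne le; split=> //; first by move=> [E1 E2]; apply: ne; rewrite E1 E2.
move=> [a b] h0 n0; have [] // := le (b, a) h0; first by case=> E1 E2; apply: n0; rewrite E1 E2.
Qed.

(** A finite element is absolute exactly off the rays, since two points in one column or row force a
    ray. *)
Lemma IA_finP a b : IA S (Some a, Some b) <->
  [/\ S (a, b), 0 < a, ~ ray S a &
    forall u v s t, S (u, v) -> S (s, t) -> 0 < u -> 0 < s ->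
      (u + s, v + t) <> (a, b)].
Proof.
split.
  move=> [[/Gamma_fin h ne irr] ab]; split=> //.
  - rewrite lt0n; apply/eqP => a0; apply: ne.
    by have [-> ->] := good_local gS h (or_introl a0).
  - move=> [y0 hy]; case: ab => [[[[? _ []]|[? _ []]]|[]] //|].
    move=> [[u v] [_ [<- <-]]]; apply; exists (a, maxn y0 b.+1).
    by split; [apply: hy; lia | left; split=> //=; lia].
  - move=> u v s t hu hs up sp [Ea Eb].
    have := irr (Some u, Some v) (Some s, Some t).
    rewrite !Gamma_fin /add2b /= Ea Eb => /(_ hu hs erefl) [[]|[]]; lia.
move=> [h ap na sum]; split; last first.
  right; exists (a, b); split=> // -[[u v]] [hu /= [[E lt]|[E lt]]]; subst.
    by apply: na; apply: ray_of_column h hu lt.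
  by apply: na; apply: (rayP gS aS h); apply: ray_swap_of_row h hu lt.
split; first exact/Gamma_fin.
  by case=> E; rewrite E in ap.
move=> [[u|] [v|]] [[s|] [t|]] // /Gamma_fin hu /Gamma_fin hs [E1 E2].
case: (posnP u) => [u0|up].
  have [_ v0] := good_local gS hu (or_introl u0).
  by right; rewrite E1 E2 u0 v0.
case: (posnP s) => [s0|sp].
  have [_ t0] := good_local gS hs (or_introl s0).
  by left; rewrite E1 E2 s0 t0 !addn0.
by case: (sum _ _ _ _ hu hs up sp); rewrite E1 E2.
Qed.

(** If [a - e1] is on the ray, then [e] splits off. Conversely, from a splitting [a = u + s] with
    [s > 0], Arfness carries column [u] to column [a - e1]. *)
Lemma IA_colP a : IA S (Some a, None) <-> ray S a /\ ~ ray S (a - e1).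
Proof.
have e0 := mult_gt0; split.
  move=> [[/Gamma_col h _ irr] _]; split=> // h'; have le := ray_mult_le h.
  have [] := irr (Some (a - e1), None) (Some e1, Some e2).
  - exact/Gamma_col.
  - exact/Gamma_fin/mult_in.
  - by rewrite /add2b /= subnK.
  - by case; lia.
  - by [].
move=> [h nh]; split; last by left; left; left; exists a.
have ap : 0 < a by have := ray_mult_le h; lia.
have key u s t : ray S u -> Gamma S (Some s, t) -> a = u + s -> s = 0.
  move=> [y0 hu] hs E; apply: contrapT => /eqP; rewrite -lt0n => sp.
  have [w hw] : exists w, S (s, w).
    case: t hs => [t /Gamma_fin|/Gamma_col [y1 hy]]; first by exists t.
    by exists y1; apply: hy.
  have up : 0 < u by have := ray_mult_le (ex_intro _ y0 hu); lia.
  apply: nh; exists (y0 + w) => y hy.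
  (* This height is chosen so that adding [w] and subtracting [e2] gives [y]. *)
  have := arf_sum (hu (y + e2 - w) _) hw up sp.
  by rewrite -E subnK ?addnK; [apply; lia | lia].
split; [exact/Gamma_col | by [] |].
move=> [[u|] v] [[s|] t] // hb hc [E1 E2].
case: v t hb hc E2 => [v|] [t|] // hb hc _.
- have us : a = s + u by rewrite addnC.
  have u0 := key _ _ _ (iffLR (Gamma_col _ _) hc) hb us.
  by right; rewrite us u0 addn0.
- have s0 := key _ _ _ (iffLR (Gamma_col _ _) hb) hc E1.
  by left; rewrite E1 s0 addn0.
- have s0 := key _ _ _ (iffLR (Gamma_col _ _) hb) hc E1.
  by left; rewrite E1 s0 addn0.
Qed.

Lemma IA_infty : ~ IA S (None, None).
Proof.
move=> [[_ _ irr] _]; have [n hn] := ray_cofinite gS.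
have [m hm] := ray_cofinite (good_swap gS).
have [] := irr (Some n, None) (None, Some m) => //.
  exact/Gamma_col/hn.
exact/Gamma_row/hm.
Qed.

End Multiplicity.

Lemma irreducible_swap S u v : irreducible (swap_set S) (v, u) -> irreducible S (u, v).
Proof.
move=> [h ne irr]; split; [exact/Gamma_swap | by case=> E1 E2; apply: ne; rewrite E1 E2 |].
move=> [b1 b2] [c1 c2] /(iffRL (Gamma_swap _ _ _)) hb /(iffRL (Gamma_swap _ _ _)) hc [E1 E2].
by case: (irr _ _ hb hc) => [|[-> ->]|[-> ->]]; [rewrite E1 E2 | left | right].
Qed.

Lemma swap_setK S : swap_set (swap_set S) = S.
Proof. by apply/seteqP; split=> -[]. Qed.

(** * Elements that every generating set must contain *)

Section LowerBound.
Variables (S : set (nat * nat)) (e1 e2 : nat).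
Hypotheses (gS : good_semigroup S) (aS : arf S).
Hypothesis mS : multiplicity_vector S (e1, e2).

Let IA_fin := IA_finP gS aS.

Lemma IA_rowP b :
  IA S (None, Some b) <-> ray (swap_set S) b /\ ~ ray (swap_set S) (b - e2).
Proof.
have P := IA_colP (good_swap gS) (arf_swap aS) (multiplicity_swap mS).
rewrite -P; split=> -[irr _]; split.
- by apply: irreducible_swap; rewrite swap_setK.
- by left; left; left; exists b => //; case: irr => /Gamma_row.
- exact: irreducible_swap.
- by left; left; right; exists b => //; case: irr => /Gamma_col.
Qed.

(** Descent: from a reducible point off the rays, subtracting [e] gives a point of [S], still off
    the rays, with the same residues. *)
Lemma IA_below a b : S (a, b) -> 0 < a -> ~ ray S a ->
  exists c1 c2, [/\ IA S (Some c1, Some c2), c1 = a %[mod e1] & c2 = b %[mod e2]].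
Proof.
elim/ltn_ind: a b => a IH b h ap na.
have [ir|nir] := pselect (IA S (Some a, Some b)); first by exists a, b.
have [u [v [s [t [hu hs up sp [Ea Eb]]]]]] : exists u v s t,
    [/\ S (u, v), S (s, t), 0 < u, 0 < s & (u + s, v + t) = (a, b)].
  apply: contrapT => no; apply: nir; apply/IA_fin; split=> // u v s t hu hs up sp E.
  by apply: no; exists u, v, s, t.
have [l1 l2] := mult_le mS hu up; have [l3 l4] := mult_le mS hs sp.
have e0 := mult_gt0 gS mS.
have := arf_sum aS mS hu hs up sp; rewrite Ea Eb => h'.
have [|||c1 [c2 [ir E1 E2]]] := IH (a - e1) _ _ h'; try lia.
  by move=> h''; apply: na; rewrite (_ : a = a - e1 + e1); [exact: rayD (mult_in mS) | lia].
exists c1, c2; split=> //.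
  by rewrite E1 -[in RHS](@subnK e1 a) ?modnDr //; lia.
by rewrite E2 -[in RHS](@subnK e2 b) ?modnDr //; lia.
Qed.

(** If [a' = a + k * e1] with [k > 0], uniqueness in column [a'] makes the second element the first
    plus [k] times [e], hence reducible. *)
Lemma IA_fin_mod_inj a b a' b' : IA S (Some a, Some b) -> IA S (Some a', Some b') ->
  a = a' %[mod e1] -> (a, b) = (a', b').
Proof.
wlog le : a b a' b' / a <= a'.
  move=> wl h h' E; case: (leqP a a') => le; first exact: wl.
  by apply/esym/wl => //; exact: ltnW.
move=> /IA_fin [h ap na _] /IA_fin [h' ap' na' irr] E.
have [k Ek] : exists k, a' = a + k * e1.
  exists ((a' - a) %/ e1); rewrite divnK ?subnKC // -eqn_mod_dvd //; exact/eqP.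
have hk := add_mul_mult gS mS k h; rewrite -Ek in hk.
have := column_unique gS aS h' hk na'.
case: k Ek hk => [|k] Ek hk Eb; first by rewrite Ek Eb !addn0.
case: (irr _ _ _ _ (add_mul_mult gS mS k h) (mult_in mS)) => //.
- by rewrite addn_gt0 ap.
- exact: mult_gt0 gS mS.
- by rewrite Ek Eb !mulSn; congr (_, _); lia.
Qed.

Lemma ray_exit a b : S (a, b) -> ~ ray S a ->
  exists k, ~ ray S (a + k * e1) /\ ray S (a + k.+1 * e1).
Proof.
move=> h na; have e0 := mult_gt0 gS mS.
have ex : exists k, `[< ray S (a + k * e1) >].
  by have [n hn] := ray_cofinite gS; exists n; apply/asboolP/hn; nia.
case: (ex_minnP ex) => -[|k] /asboolP hk min; first by rewrite addn0 in hk.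
exists k; split=> // hk'; have /min : `[< ray S (a + k * e1) >] by apply/asboolP.
by rewrite ltnn.
Qed.

Variable eta : set (natbar * natbar).
Hypothesis geta : generating S eta.

(* Trimming at [(a, b - 1)] removes only [(a, b)]. *)
Lemma generating_fin a b : IA S (Some a, Some b) -> eta (Some a, Some b).
Proof.
move=> /IA_fin [h ap na irr].
have bp : 0 < b by rewrite -(good_gt0 gS h).
(* A point further right would give, by a minimum with [(a, b)], a second point in column [a]. *)
have row u : S (u, b - 1) -> u <= a.
  move=> hu; rewrite leqNgt; apply/negP => lt.
  have := good_min gS h hu; rewrite (minn_idPl (ltnW lt)) (minn_idPr (leq_subr _ _)).
  by move=> h'; have := column_unique gS aS h h' na; lia.
have rowA : ~ ray (swap_set S) (b - 1).
  by move=> [x0 hx]; have := row (maxn x0 a.+1) (hx _ (leq_maxl _ _)); lia.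
have hx u v s t : S (u, v) -> S (s, t) -> 0 < u -> 0 < s ->
    u + s = a -> v + t <= b - 1.
  move=> hu hs up sp E; have h' := good_add gS hu hs; rewrite E in h'.
  by case: (irr _ _ _ _ hu hs up sp); rewrite E (column_unique gS aS h h' na).
have hy u v s t : S (u, v) -> S (s, t) -> 0 < u -> 0 < s ->
    v + t = b - 1 -> u + s <= a.
  by move=> hu hs _ _ E; apply: row; rewrite -E; apply: good_add.
have nt : ~ trim S a (b - 1) (a, b) by case=> _; apply; left; split=> //=; lia.
have [p hp [Gp nGp]] := generating_meets_trim gS aS hx hy
  (fun k => False_ind _ (na k)) (fun k => False_ind _ (rowA k)) geta h nt.
case: (Gamma_trim Gp nGp) => [[]//|[]//|[[u v] Ep [hu nT]]].
have [[/= E lt]|[/= E lt]] : (u = a /\ b - 1 < v) \/ (v = b - 1 /\ a < u).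
    by apply: contrapT => no; apply: nT.
  rewrite E in hu Ep; rewrite (column_unique gS aS h hu na).
  by rewrite -[(Some a, Some v)]Ep.
by rewrite E in hu; have := row _ hu; lia.
Qed.

(** Trim at the exit [(x, y)]. A sum of nonzero elements in column [x] is [e] plus the only point of
    column [x - e1], so it is [(x, y)] itself; likewise for row [y]. Finite elements of [eta] are
    off the rays and survive. *)
Lemma generating_exit a b k : IA S (Some a, Some b) ->
  ~ ray S (a + k * e1) -> ray S (a + k.+1 * e1) ->
  eta (Some (a + k.+1 * e1), None) \/ eta (None, Some (b + k.+1 * e2)).
Proof.
move=> /IA_fin [h ap na irr] nk ak.
have hk := add_mul_mult gS mS k h; have hk' := add_mul_mult gS mS k.+1 h.
move: ak hk'; set x := a + _; set y := b + _ => ax hxy.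
have hx u v s t : S (u, v) -> S (s, t) -> 0 < u -> 0 < s ->
    u + s = x -> v + t <= y.
  move=> hu hs up sp E; have := arf_sum aS mS hu hs up sp.
  rewrite E (_ : x - e1 = a + k * e1); last by rewrite /x mulSn; lia.
  by move=> h'; have := column_unique gS aS hk h' nk; rewrite /y mulSn; lia.
have hy u v s t : S (u, v) -> S (s, t) -> 0 < u -> 0 < s ->
    v + t = y -> u + s <= x.
  move=> hu hs up sp E; have := arf_sum aS mS hu hs up sp.
  rewrite E (_ : y - e2 = b + k * e2); last by rewrite /y mulSn; lia.
  by move=> h'; have := row_unique gS aS hk h' nk; rewrite /x mulSn; lia.
have ay := ray_swapP gS aS hxy ax.
have [y0 hy0] := ax; have hv := hy0 (maxn y0 y.+1) (leq_maxl _ _).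
have nt : ~ trim S x y (x, maxn y0 y.+1) by case=> _; apply; left; split=> //=; lia.
have [p hp [Gp nGp]] := generating_meets_trim gS aS hx hy
  (fun _ => or_intror ay) (fun _ => or_intror ax) geta hv nt.
case: (Gamma_trim Gp nGp) => [[<- _]|[<- _]|[[u v] Ep [hu nT]]]; [by left|by right|].
have [/(_ _ hp) IAp _] := geta; rewrite Ep in IAp.
move/IA_fin: IAp => [_ _ nu _].
case: nT; split=> // -[[/= E _]|[/= E _]]; apply: nu; first by rewrite E.
by apply: (rayP gS aS hu); rewrite E.
Qed.

(** Trimming at [(x, 0)] erases column [x]. A sum of nonzero elements there would give a point in
    column [x - e1], and by descent a finite irreducible in the residue class of [x]. *)
Lemma generating_col x : IA S (Some x, None) ->
  (forall c1 c2, IA S (Some c1, Some c2) -> c1 <> x %[mod e1]) ->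
  eta (Some x, None).
Proof.
move=> /(IA_colP gS aS mS) [ax nx] un.
have hx u v s t : S (u, v) -> S (s, t) -> 0 < u -> 0 < s -> u + s = x -> v + t <= 0.
  move=> hu hs up sp E; have := arf_sum aS mS hu hs up sp.
  have [l1 _] := mult_le mS hu up; have [l2 _] := mult_le mS hs sp.
  have e0 := mult_gt0 gS mS.
  rewrite E => h; have [|c1 [c2 [ir E1 _]]] := IA_below h _ nx; first by lia.
  by case: (un _ _ ir); rewrite E1 -[in RHS](@subnK e1 x) ?modnDr //; lia.
have hy u v s t : S (u, v) -> S (s, t) -> 0 < u -> 0 < s -> v + t = 0 -> u + s <= x.
  by move=> hu _ up _; rewrite (good_gt0 gS hu) in up; lia.
have n0 := ray0 (good_swap gS).
have [y0 hy0] := ax; have hv := hy0 y0.+1 (leqnSn _).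
have nt : ~ trim S x 0 (x, y0.+1) by case=> _; apply; left; split.
have [p hp [Gp nGp]] := generating_meets_trim gS aS hx hy
  (fun _ => or_introl erefl) (fun k => False_ind _ (n0 k)) geta hv nt.
case: (Gamma_trim Gp nGp) => [[<- _]//|[]//|[[u v] Ep [hu nT]]].
have [/(_ _ hp) IAp _] := geta; rewrite Ep in IAp.
move/IA_fin: IAp => [_ up nu _].
case: nT; split=> // -[[/= E _]|[/= E _]]; first by apply: nu; rewrite E.
by rewrite (good_gt0 gS hu) E in up.
Qed.

(** The same with row [y] erased, by trimming at [(0, y)]. *)
Lemma generating_row y : IA S (None, Some y) ->
  (forall c1 c2, IA S (Some c1, Some c2) -> c2 <> y %[mod e2]) ->
  eta (None, Some y).
Proof.
move=> /IA_rowP [ay ny] un.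
have hy u v s t : S (u, v) -> S (s, t) -> 0 < u -> 0 < s -> v + t = y -> u + s <= 0.
  move=> hu hs up sp E; have := arf_sum aS mS hu hs up sp.
  have [l1 l1'] := mult_le mS hu up; have [l2 l2'] := mult_le mS hs sp.
  have e0 := mult_gt0 gS mS.
  rewrite E => h; have [||c1 [c2 [ir _ E2]]] := IA_below h _ _; first by lia.
    by move=> h'; apply: ny; apply: ray_swapP h h'.
  by case: (un _ _ ir); rewrite E2 -[in RHS](@subnK e2 y) ?modnDr //; lia.
have hx u v s t : S (u, v) -> S (s, t) -> 0 < u -> 0 < s -> u + s = 0 -> v + t <= y.
  by move=> _ _; lia.
have n0 := ray0 gS.
have [x0 hx0] := ay; have hv : S (x0.+1, y) := hx0 x0.+1 (leqnSn _).
have nt : ~ trim S 0 y (x0.+1, y) by case=> _; apply; right; split.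
have [p hp [Gp nGp]] := generating_meets_trim gS aS hx hy
  (fun k => False_ind _ (n0 k)) (fun _ => or_introl erefl) geta hv nt.
case: (Gamma_trim Gp nGp) => [[]//|[<- _]//|[[u v] Ep [hu nT]]].
have [/(_ _ hp) IAp _] := geta; rewrite Ep in IAp.
move/IA_fin: IAp => [_ up nu _].
case: nT; split=> // -[[/= E _]|[/= E _]]; first by rewrite E in up.
by apply: nu; apply: (rayP gS aS hu); rewrite E.
Qed.

End LowerBound.

(** * Counting generators by residues *)

Section Residues.
Variables (S : set (nat * nat)) (e1 e2 : nat).
Hypotheses (gS : good_semigroup S) (aS : arf S).
Hypothesis mS : multiplicity_vector S (e1, e2).

(** When [(x, oo)] is irreducible, the at most one such [c] is the finite irreducible whose exit
    lies in column [x]. *)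
Definition matching (x : nat) : set (nat * nat) :=
  [set c | IA S (fin2 c) /\ c.1 = x %[mod e1]].

(* A finite irreducible [c] occupies two residues, [c.1] modulo [e1] and [c.2]
   modulo [e2]; it is labelled by the first one, and the element [(oo, y)] or
   [(x, oo)] by the second one. *)
Definition label (p : natbar * natbar) : nat :=
  match p with
  | (Some a, Some _) => a %% e1
  | (Some a, None) => if `[< exists c, matching a c >]
                      then e1 + (xget (0, 0) (matching a)).2 %% e2 else a %% e1
  | (None, Some b) => e1 + b %% e2
  | (None, None) => 0
  end.

(** The element picked by [xget] is [c], the matching element being unique. *)
Lemma label_matching x c : matching x c -> label (Some x, None) = e1 + c.2 %% e2.
Proof.
move=> h; rewrite /label ifT; last by apply/asboolP; exists c.
case: c h => c1 c2 h; have [] := xgetPex (0, 0) (ex_intro _ _ h).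
case: h => /= ir E; case: (xget _ _) => d1 d2 /= ir' E'.
by have [_ ->] := IA_fin_mod_inj gS aS mS ir' ir (etrans E' (esym E)).
Qed.

Lemma label_unmatched x : ~ (exists c, matching x c) -> label (Some x, None) = x %% e1.
Proof. by move=> h; rewrite /label ifF //; apply/asboolP. Qed.

Lemma IA_col_residue r : r < e1 -> exists x, [/\ IA S (Some x, None), x %% e1 = r &
  forall a, ray S a -> a %% e1 = r -> exists k, a = x + k * e1].
Proof.
move=> lt; have [x [h1 h2 h3 h4]] := least_residue (mult_gt0 gS mS)
  (ray_cofinite gS) (fun a => ray_mult_le gS mS (a := a)) lt.
by exists x; split=> //; apply/(IA_colP gS aS mS).
Qed.

Lemma IA_row_residue r : r < e2 -> exists y, [/\ IA S (None, Some y), y %% e2 = r &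
  forall b, ray (swap_set S) b -> b %% e2 = r -> exists k, b = y + k * e2].
Proof.
move=> lt; have [x [h1 h2 h3 h4]] := least_residue (mult_gt0r gS mS)
  (ray_cofinite (good_swap gS))
  (fun a => ray_mult_le (good_swap gS) (multiplicity_swap mS) (a := a)) lt.
by exists x; split=> //; apply/(IA_rowP gS aS mS).
Qed.

(** A residue modulo [e1] is realised by a forced finite element or else a forced [(x, oo)]; one
    modulo [e2] by either infinite element of an exit or else a forced [(oo, y)]. *)
Lemma label_onto eta : generating S eta -> `I_(e1 + e2) `<=` label @` eta.
Proof.
move=> geta n /= lt; case: (ltnP n e1) => [lt1|ge].
  have [x [ir E _]] := IA_col_residue lt1.
  have [[[c1 c2] [irc Ec]]|no] := pselect (exists c, matching x c).
    exists (Some c1, Some c2); first exact: (generating_fin gS aS geta).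
    by rewrite /label Ec.
  exists (Some x, None); last by rewrite label_unmatched.
  apply: (generating_col gS aS mS geta) => // c1 c2 irc Ec.
  by apply: no; exists (c1, c2).
have lt2 : n - e1 < e2 by lia.
have [y [ir E _]] := IA_row_residue lt2.
have En : n = e1 + y %% e2 by rewrite E subnKC.
have [[c1 [c2 [irc Ec]]]|no] := pselect (exists c1 c2,
    IA S (Some c1, Some c2) /\ c2 = y %[mod e2]).
  have [h _ na _] := iffLR (IA_finP gS aS c1 c2) irc.
  have [k [nk ak]] := ray_exit gS mS h na.
  have [hx|hy] := generating_exit gS aS mS geta irc nk ak.
    exists (Some (c1 + k.+1 * e1), None) => //.
    rewrite (@label_matching _ (c1, c2)) ?Ec //.
    by split=> //=; rewrite addnC modnMDl.
  exists (None, Some (c2 + k.+1 * e2)) => //.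
  by rewrite /label En -Ec [c2 + _]addnC modnMDl.
exists (None, Some y) => //.
apply: (generating_row gS aS mS geta) => // c1 c2 irc Ec.
by apply: no; exists c1, c2.
Qed.

(** Of the two infinite elements at each exit, only [(oo, y)] is kept. *)
Definition standard_generators : set (natbar * natbar) :=
  [set p | IA S p /\ forall a, p = (Some a, None) -> ~ exists c, matching a c].

Lemma label_lt p : standard_generators p -> label p < e1 + e2.
Proof.
have p1 := mult_gt0 gS mS; have p2 := mult_gt0r gS mS.
case: p => [[a|] [b|]] [ir un] //.
- by rewrite /label ltn_addr // ltn_pmod.
- by rewrite label_unmatched ?ltn_addr ?ltn_pmod //; apply: un.
- by rewrite /label ltn_add2l ltn_pmod.
- by rewrite /label addn_gt0 p1.
Qed.

(** Labels of rows start at [e1]; below it, a finite element and a column could collide only if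
    matching, and matched columns are dropped. *)
Lemma label_inj : {in standard_generators &, injective label}.
Proof.
have p1 := mult_gt0 gS mS; have p2 := mult_gt0r gS mS.
have lt1 a : a %% e1 < e1 by rewrite ltn_pmod.
have fin_col a b c : IA S (Some a, Some b) -> standard_generators (Some c, None) ->
    a %% e1 <> c %% e1.
  by move=> h [_ /(_ _ erefl) un] E; apply: un; exists (a, b).
have col a : standard_generators (Some a, None) -> label (Some a, None) = a %% e1.
  by move=> [_ /(_ _ erefl)]; apply: label_unmatched.
move=> p q /set_mem hp /set_mem hq.
case: p hp => [[a|] [b|]] hp; last by case: hp => /(IA_infty gS).
- case: q hq => [[c|] [d|]] hq; last by case: hq => /(IA_infty gS).
  + move=> E; case: hp hq => hp _ [hq _].
    by case: (IA_fin_mod_inj gS aS mS hp hq E) => -> ->.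
  + by rewrite (col _ hq) => E; case: (fin_col _ _ _ (proj1 hp) hq).
  + by move=> /= E; move: (lt1 a); rewrite E; lia.
- rewrite (col _ hp).
  case: q hq => [[c|] [d|]] hq; last by case: hq => /(IA_infty gS).
  + by move=> E; case: (fin_col _ _ _ (proj1 hq) hp).
  + rewrite (col _ hq) => E.
    have [[/(IA_colP gS aS mS) [ha na] _] [/(IA_colP gS aS mS) [hc nc] _]] := (hp, hq).
    rewrite (@least_inj _ _ a c p1 _ ha na hc nc E) // => u k hu.
    exact: ray_mulD (mult_in mS).
  + by move=> /= E; move: (lt1 a); rewrite E; lia.
- case: q hq => [[c|] [d|]] hq; last by case: hq => /(IA_infty gS).
  + by move=> /= E; move: (lt1 c); rewrite -E; lia.
  + by rewrite (col _ hq) => /= E; move: (lt1 c); rewrite -E; lia.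
  + move=> /= /addnI E.
    have [[/(IA_rowP gS aS mS) [ha na] _] [/(IA_rowP gS aS mS) [hc nc] _]] := (hp, hq).
    rewrite (@least_inj _ _ b d p2 _ ha na hc nc E) // => u k hu.
    exact: ray_mulD (good_swap gS) hu (mult_in (multiplicity_swap mS)).
Qed.

(** * The standard generators generate [S] *)

Section UpperBound.
Variable T : set (nat * nat).
Hypotheses (gT : good_semigroup T) (sub : standard_generators `<=` Gamma T).
Hypothesis TS : T `<=` S.

(** Rays absorb addition of elements of [S], so both summands of a reducible point off the rays are
    off the rays and induction applies. *)
Lemma generated_fin a b : S (a, b) -> ~ ray S a -> T (a, b).
Proof.
elim/ltn_ind: a b => a IH b h na.
case: (posnP a) => [a0|ap].
  by have [-> ->] := good_local gS h (or_introl a0); exact: good_zero.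
have [ir|nir] := pselect (IA S (Some a, Some b)).
  by apply/Gamma_fin/sub; split.
apply: contrapT => no; apply: nir; apply/(IA_finP gS aS); split=> //.
move=> u v s t hu hs up sp [Ea Eb]; apply: no; rewrite -Ea -Eb.
apply: good_add => //.
- by apply: IH => // [|hA]; [lia | apply: na; rewrite -Ea; exact: rayD hs].
- by apply: IH => // [|hA]; [lia | apply: na; rewrite -Ea addnC; exact: rayD hu].
Qed.

Lemma not_ray_mult x c : matching x c -> ~ ray S e1.
Proof.
case: c => c1 c2 [/(IA_finP gS aS) [h cp nc _] _] he.
by apply: nc; apply: (ray_le_mult gS aS mS he h).
Qed.

(** Supplies the point of [T] by which its infinite rows are shifted by [e2]: either [e] is off the
    rays, or [(oo, e2)] is a standard generator. *)
Lemma generated_mult_row : exists x, T (x, e2).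
Proof.
have [he|ne] := pselect (ray (swap_set S) e2); last first.
  exists e1; apply: generated_fin; first exact: mult_in mS.
  by move=> he; apply: ne; apply: (ray_swapP gS aS (mult_in mS)).
have /Gamma_row [x0 hx] : Gamma T (None, Some e2); last by exists x0; apply: hx.
apply: sub; split=> //; apply/(IA_rowP gS aS mS); split=> //.
by rewrite subnn; exact: ray0 (good_swap gS).
Qed.

Lemma generated_mult_col : exists y, T (e1, y).
Proof.
have [he|ne] := pselect (ray S e1); last first.
  by exists e2; apply: generated_fin => //; exact: mult_in mS.
have /Gamma_col [y0 hy] : Gamma T (Some e1, None); last by exists y0; apply: hy.
apply: sub; split; last by move=> _ [<-] [c /not_ray_mult].
by apply/(IA_colP gS aS mS); split=> //; rewrite subnn; exact: ray0.
Qed.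

Lemma generated_row b : ray (swap_set S) b -> ray (swap_set T) b.
Proof.
move=> hb; have [y [ir E mul]] := IA_row_residue (ltn_pmod b (mult_gt0r gS mS)).
have [k ->] := mul _ hb erefl; have [x hx] := generated_mult_row.
have /Gamma_row hy : Gamma T (None, Some y) by apply: sub; split.
exact: (ray_mulD _ (good_swap gT) hy hx).
Qed.

(* (G3) climbs the column [x] of [T]: each element of it lies in a row that [T]
   contains eventually. *)
Lemma generated_climb x w : ray S x -> T (x, w) -> ray T x.
Proof.
move=> ax hw.
have climb n : exists2 w', n <= w' & T (x, w').
  elim: n => [|n [w' le hw']]; first by exists w.
  have [x0 hx0] := generated_row (ray_swapP gS aS (TS hw') ax).
  have hx : T (maxn x0 x.+1, w') := hx0 _ (leq_maxl _ _).
  have [|w2 lt h2] := good_up gT hw' hx; first by lia.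
  by exists w2 => //; lia.
have [n hn] := good_conductor gT; exists n => y hy.
have [w' le hw'] := climb y.
have := good_min gT hw' (hn (maxn x n) y (leq_maxr _ _) hy).
by rewrite (minn_idPl (leq_maxl _ _)) (minn_idPr le).
Qed.

Lemma generated_col a : ray S a -> ray T a.
Proof.
move=> ha; have [x [ir E mul]] := IA_col_residue (ltn_pmod a (mult_gt0 gS mS)).
have [k Ek] := mul _ ha erefl; have [y hy] := generated_mult_col.
have [ax _] := iffLR (IA_colP gS aS mS x) ir.
suff hx : ray T x by rewrite Ek; exact: ray_mulD hy.
have [[[c1 c2] hc]|no] := pselect (exists c, matching x c); last first.
  by apply/Gamma_col/sub; split=> // _ [<-].
have ne := not_ray_mult hc; case: hc => /(IA_finP gS aS) [h cp nc _] /= Ec.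
have le : c1 < x.
  rewrite ltnNge; apply/negP => le; apply: nc.
  rewrite -(subnKC le) -(@divnK e1 (c1 - x)); first exact: ray_mulD (mult_in mS).
  by rewrite -eqn_mod_dvd //; apply/eqP.
(* The start of the climb is the exit of [(c1, c2)], reached inside [T] by adding [e] repeatedly. *)
apply: (@generated_climb x (c2 + (x - c1) %/ e1 * e2)) => //.
have -> : x = c1 + (x - c1) %/ e1 * e1.
  by rewrite divnK ?subnKC ?(ltnW le) // -eqn_mod_dvd ?(ltnW le) //; apply/eqP.
have hT := generated_fin h nc; have eT := generated_fin (mult_in mS) ne.
rewrite addKn mulnK ?(mult_gt0 gS mS) //.
elim: (_ %/ _) => [|j IH]; first by rewrite !addn0.
by rewrite !mulSn !(addnCA _ e1) !(addnCA _ e2); exact: good_add.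
Qed.

Lemma generated_all : T = S.
Proof.
apply/seteqP; split=> // -[a b] h.
have [ha|na] := pselect (ray S a); last exact: generated_fin.
apply: ray_box => //; first exact: generated_col.
by apply: generated_row; apply: ray_swapP h ha.
Qed.

End UpperBound.

Lemma generating_standard : generating S standard_generators.
Proof.
split; first by move=> p [].
split=> //; first by move=> p [[[]]].
by move=> T gT sub TS; apply: generated_all.
Qed.

End Residues.

Theorem corollary50 (S : set (nat * nat)) (e1 e2 : nat) :
  good_semigroup S -> arf S -> multiplicity_vector S (e1, e2) ->
  edim_eq S (e1 + e2)%N.
Proof.
move=> gS aS mS.
have onto := label_onto gS aS mS.
have gen := generating_standard gS aS mS.
split; last first.
  move=> eta geta.
  exact: card_le_trans (subset_card_le (onto _ geta)) (card_image_le _ _).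
exists (standard_generators S e1); split=> //.
rewrite card_eq_sym.
(* On the standard generators [label] is a bijection onto the first [e1 + e2] numbers. *)
rewrite (_ : `I_(e1 + e2) = label S e1 e2 @` standard_generators S e1).
  exact: inj_card_eq (label_inj gS aS mS).
apply/seteqP; split; first exact: onto.
by move=> _ [p hp <-]; apply: label_lt.
Qed.
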